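(* Let $(X,d)$ be a proper, uniquely geodesic, straight metric space. For any basepoint $b\in X$ there is a continuous surjection $\Pi:\overline{X}^h\to\overline{X}^v_b$ from the horofunction compactification to the visual compactification based at $b$ such that $\Pi(B_\gamma)=\gamma$ for every geodesic ray $\gamma$ starting at $b$, and $\Pi(h(p))=p$ for every $p\in X$. In particular, the horofunction compactification of $X$ is finer than the visual compactification of $X$ based at any point.
   Context: A geodesic in a metric space $(X,d)$ is a map $\gamma:I\to X$ from an interval $I\subset\mathbb{R}$ with $d(\gamma(t),\gamma(s))=|t-s|$ (geodesics with the same image and orientation are identified). $X$ is proper if closed balls are compact; uniquely geodesic if any two distinct points are joined by a unique geodesic; straight if every geodesic segment is contained in a unique bi-infinite geodesic. A compactification of $X$ is a pair $(f,\overline{X})$ with $\overline X$ compact and $f:X\to\overline X$ an embedding with dense image. $(f_1,X_1)$ is finer than $(f_2,X_2)$ if there is a continuous map $\overline f_2:X_1\to X_2$ with $\overline f_2\circ f_1=f_2$. Visual compactification based at $b$: let $D_b$ be the set of geodesic rays $\gamma:[0,\infty)\to X$ with $\gamma(0)=b$, with the topology of uniform convergence on compact sets. The map $(\theta,r)\mapsto\theta(r)$ is a homeomorphism $D_b\times[0,\infty)/(D_b\times\{0\})\to X$; the space $\overline{X}^v_b=X\cup D_b$ is given the topology of $D_b\times[0,\infty]/(D_b\times\{0\})$, with $D_b\times\{\infty\}$ identified with $D_b$. The embedding of $X$ is the inclusion. Horofunction compactification: fix a basepoint $b$ and let $h:X\to C(X)$, $h(x)(\cdot)=d(x,\cdot)-d(x,b)$,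 where $C(X)$ (continuous real functions) has the topology of uniform convergence on compact sets. For a proper, uniquely geodesic, straight metric space $X$, $h$ is an embedding and $\overline{X}^h=\overline{h(X)}$ is compact; the horofunction compactification is $(h,\overline{X}^h)$ (independent of $b$ up to isomorphism). For a geodesic ray $\gamma$, $B_\gamma:=\lim_{t\to\infty}h(\gamma(t))$, which exists in $\overline{X}^h$. *)

(* Defs.v *)
From HB Require Import structures.
From mathcomp Require Import all_boot all_order all_algebra.
From mathcomp Require Import all_classical all_reals all_analysis.

Set Implicit Arguments.
Unset Strict Implicit.
Unset Printing Implicit Defensive.

Import Order.TTheory GRing.Theory Num.Theory.
Import numFieldNormedType.Exports.

Local Open Scope classical_set_scope.
Local Open Scope ring_scope.

Section geodesics.
Context {R : realType} {X : metricType R}.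

Definition proper_space := forall (x : X) (r : R), compact [set y | mdist x y <= r].

Definition geodesic (I : set R) (g : I -> X) :=
  is_interval I /\ forall s t : I, mdist (g t) (g s) = `|\val t - \val s|.

(* The domain of a geodesic that joins two points is a compact interval. *)
Definition joins (I : set R) (g : I -> X) (x y : X) :=
  exists s t : I,
    [/\ g s = x, g t = y & forall u : I, \val s <= \val u <= \val t].

Definition co_oriented (I J : set R) (g : I -> X) (k : J -> X) :=
  forall (s t : I) (s' t' : J), g s = k s' -> g t = k t' ->
    (\val s < \val t <-> \val s' < \val t').

(* Same image and same orientation: the identification made on geodesics. *)
Definition same_geodesic (I J : set R) (g : I -> X) (k : J -> X) :=
  range g = range k /\ co_oriented g k.

Definition contained_in (I J : set R) (g : I -> X) (k : J -> X) :=
  range g `<=` range k /\ co_oriented g k.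

Definition uniquely_geodesic := forall x y : X, x <> y ->
  (exists (I : set R) (g : I -> X), geodesic g /\ joins g x y) /\
  (forall (I J : set R) (g : I -> X) (k : J -> X),
     geodesic g -> joins g x y -> geodesic k -> joins k x y ->
     same_geodesic g k).

(* Segments are nondegenerate: a single point is not a segment. *)
Definition straight := forall (x y : X) (I : set R) (g : I -> X),
  x <> y -> geodesic g -> joins g x y ->
  (exists k : [set: R] -> X, geodesic k /\ contained_in g k) /\
  (forall k k' : [set: R] -> X,
     geodesic k -> contained_in g k -> geodesic k' -> contained_in g k' ->
     same_geodesic k k').

End geodesics.

Arguments proper_space {R} X.
Arguments uniquely_geodesic {R} X.
Arguments straight {R} X.

Section half_lines.
Variable R : realType.

Definition half_line : set R := [set t | 0 <= t].
Definition half_line_bar : set (\bar R) := [set t | (0 <= t)%E].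

Definition half_line_infty : set_system half_line :=
  filter_from [set: R] (fun M => [set t : half_line | M < \val t]).

Lemma half_line0_subproof : (0 : R) \in half_line.
Proof. by rewrite inE /half_line /=. Qed.

Definition half_line0 : half_line := exist _ 0 half_line0_subproof.

Lemma half_line_EFin (r : R) : r%:E \in half_line_bar -> r \in half_line.
Proof. by rewrite !inE /half_line /half_line_bar /= lee_fin. Qed.

Lemma half_line_ninfty : (-oo)%E \in half_line_bar -> False.
Proof. by rewrite inE /half_line_bar /= leeNy_eq. Qed.

End half_lines.

Arguments half_line R : clear implicits.
Arguments half_line_bar R : clear implicits.
Arguments half_line_infty R : clear implicits.
Arguments half_line0 R : clear implicits.

(* The topology of [{family compact, U -> V}] is that of uniform convergence
   on compact sets. *)
Definition rays {R : realType} {X : metricType R} (b : X) :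
    set {family compact, half_line R -> X} :=
  [set g | geodesic g /\ g (half_line0 R) = b].

Section visual_compactification.
Context {R : realType} {X : metricType R} (b : X).

Definition visual : Type := (X + rays b)%type.
HB.instance Definition _ := Choice.on visual.

Definition visual_emb (p : X) : visual := inl p.
Definition visual_end (g : rays b) : visual := inr g.

(* On a proper, uniquely geodesic, straight space with at least two points,
   [polar] induces a bijection from D_b x [0, oo] / (D_b x {0}) onto the
   disjoint union of X and D_b, where D_b is [rays b]. *)
Definition polar (p : rays b * half_line_bar R) : visual :=
  match p.2 with
  | exist (EFin r) hr => visual_emb (\val p.1 (exist _ r (half_line_EFin hr)))
  | exist +oo%E _ => visual_end p.1
  | exist -oo%E h => False_rect _ (half_line_ninfty h)
  end.

(* The quotient topology: the finest one that makes [polar] continuous. *)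
Definition visual_open (U : set visual) := open (polar @^-1` U).

Let visual_openT : visual_open [set: visual].
Proof. by rewrite /visual_open preimage_setT; exact: openT. Qed.

Let visual_openI : setI_closed visual_open.
Proof. by move=> U V; rewrite /visual_open preimage_setI; exact: openI. Qed.

Let visual_open_bigU (I : Type) (f : I -> set visual) :
  (forall i, visual_open (f i)) -> visual_open (\bigcup_i f i).
Proof.
move=> fo; rewrite /visual_open preimage_bigcup.
by apply: bigcup_open => i _; exact: fo.
Qed.

HB.instance Definition _ :=
  isOpenTopological.Build visual visual_openT visual_openI visual_open_bigU.

End visual_compactification.

Section horofunction_compactification.
Context {R : realType} {X : metricType R} (o : X).

Definition cfun : set {family compact, X -> R} := [set f | continuous f].

Definition horo_fun (x y : X) : R := mdist x y - mdist x o.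

Lemma horo_fun_continuous x : continuous (horo_fun x).
Proof.
move=> y; apply: cvgB; last exact: cvg_cst.
apply/cvgrPdist_lt => e e0; near=> z.
have yz : mdist y z < e.
  by near: z; have := nbhsx_ballx y e e0; rewrite ballEmdist.
apply: le_lt_trans yz; rewrite ler_norml lerBlDr lerNl opprB lerBlDr.
by rewrite addrC metric_triangle [X in X + _]metric_sym addrC metric_triangle.
Unshelve. all: by end_near. Qed.

Definition horo_map (x : X) : cfun :=
  exist _ (horo_fun x : {family compact, X -> R})
    (mem_set (@horo_fun_continuous x)).

Definition horo_closure : set cfun := closure (range horo_map).
Definition horo : Type := horo_closure.
HB.instance Definition _ := Topological.on horo.

Definition horo_emb (x : X) : horo :=
  exist _ (horo_map x) (mem_set (subset_closure (imageT horo_map x))).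
HB.instance Definition _ := isPointed.Build horo (horo_emb o).

Definition busemann (g : half_line R -> X) : horo :=
  lim (horo_emb (g t) @[t --> half_line_infty R]).

End horofunction_compactification.

Section compactifications.
Context {X : topologicalType}.

Definition embedding {Y : topologicalType} (f : X -> Y) :=
  injective f /\
  forall U : set X, open U <-> exists2 V : set Y, open V & f @^-1` V = U.

Definition compactification {Y : topologicalType} (f : X -> Y) :=
  [/\ compact [set: Y], embedding f & dense (range f)].

Definition finer {Y Z : topologicalType} (f : X -> Y) (g : X -> Z) :=
  [/\ compactification f, compactification g &
      exists2 F : Y -> Z, continuous F & F \o f = g].

End compactifications.

(* Main.v *)
Require Import Defs.
From HB Require Import structures.
From mathcomp Require Import all_boot all_order all_algebra.
From mathcomp Require Import all_classical all_reals all_analysis.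
From mathcomp Require Import ring lra.

Set Implicit Arguments.
Unset Strict Implicit.
Unset Printing Implicit Defensive.

Import Order.TTheory GRing.Theory Num.Theory.
Import numFieldNormedType.Exports.

Local Open Scope classical_set_scope.
Local Open Scope ring_scope.

(** A horofunction [xi] at infinity determines a direction at [b]. Say [xi] is
the limit of [d(x_n, .) - d(x_n, o)] with [x_n] going to infinity, and that the
lines from [b] through [x_n] converge to a line [c] with [c 0 = b]. Along such a
line the distance to [x_n] varies at unit speed, behind [b] as well as in front
of it, so in the limit [xi (c t) = xi b - t] for every real [t], negative ones
included. The point [y = c (-1)] one unit behind [b] makes the direction unique:
if another ray [g] from [b] also satisfies [xi (g u) = xi b - u], then, [xi]
being nonexpansive,
  [d(y, g u) >= xi y - xi (g u) = 1 + u = d(y, b) + d(b, g u)],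
so [b] lies between [y] and [g u]. In a straight space geodesics do not branch
([nonbranching]), hence [g] is the continuation beyond [b] of the segment from
[y] to [b], that is, the ray [c] itself.

The map [Pi] and its continuity come from a closed relation and compactness
instead of sequences. Besides a horofunction, the relation [points_to] involves
polar coordinates [(g, r)], with [g] a ray and [0 <= r <= oo], and a point [y]
behind [b]. It is closed ([closed_points_to]), it determines the point of the
visual compactification with coordinates [(g, r)] ([points_to_functional], the
argument above), and these extra variables range over a compact set
([compact_polar_box]). Projections along compact sets are closed maps
([closed_projection]); this gives at once that every horofunction is related to
some coordinates, since those of the points of [X] are and they are dense, and
that preimages of closed sets under [Pi] are closed.

Compactness of the space of rays and of the space of horofunctions is an
Arzela-Ascoli argument: both consist of nonexpansive functions, on which
pointwise convergence is uniform on compact sets ([nonexpansive_cvg_family]).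
The visual compactification is compact, with [X] dense in it, as the continuous
image of the other one. A one-point space has no rays and is treated apart. *)

(** * Geometry of straight spaces *)

Section straight_geometry.
Context {R : realType} {X : metricType R}.
Implicit Types (x y p q b : X).

Definition isometric_on (A : set R) (f : R -> X) :=
  forall s t, A s -> A t -> mdist (f s) (f t) = `|s - t|.

Lemma isometric_on_le (A : set R) (f : R -> X) :
  (forall s t, A s -> A t -> s <= t -> mdist (f s) (f t) = t - s) ->
  isometric_on A f.
Proof.
move=> fA s t As At; have [st|/ltW ts] := leP s t.
  by rewrite fA// distrC ger0_norm ?subr_ge0.
by rewrite metric_sym fA// ger0_norm ?subr_ge0.
Qed.

Definition arc (L : R) : set R := [set u | 0 <= u <= L].

Lemma arc_interval L : is_interval (arc L).
Proof. by move=> s t /andP[s0 _] /andP[_ tL] u; rewrite /arc/=; lra. Qed.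

Lemma geodesic_restrict (A : set R) (f : R -> X) :
  is_interval A -> isometric_on A f -> geodesic (fun u : A => f (\val u)).
Proof.
move=> iA fA; split=> // s t.
by rewrite fA//; [exact: (set_valP t)|exact: (set_valP s)].
Qed.

Lemma joins_arc L (f : R -> X) : 0 <= L ->
  joins (fun u : arc L => f (\val u)) (f 0) (f L).
Proof.
move=> L0.
have a0 : 0 \in arc L by rewrite inE /arc/=; lra.
have aL : L \in arc L by rewrite inE /arc/=; lra.
exists (exist _ 0 a0), (exist _ L aL); split=> // u.
exact: (set_valP u).
Qed.

Definition Rpoint (u : R) : [set: R] := exist _ u (in_setT u).

Lemma RpointK (u : [set: R]) : Rpoint (\val u) = u.
Proof. exact: val_inj. Qed.

Hypothesis X_uniq : uniquely_geodesic X.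
Hypothesis X_straight : straight X.

(** The line is reparametrized by [u |-> a + u], where [a] is the time at which it
passes through [x]; as inclusion of geodesics preserves orientation, [y] comes
later, hence at time [mdist x y]. *)
Lemma line_through x y : x <> y ->
  exists c : R -> X,
    [/\ isometric_on setT c, c 0 = x & c (mdist x y) = y].
Proof.
move=> xy; have [[I [g [gg xgy]]] _] := X_uniq xy.
have [[k [kk [gk co]]] _] := X_straight xy gg xgy.
have [s [t [gs gt st]]] := xgy.
have [a _ ka] : range k x by apply: gk; exists s.
have [e _ ke] : range k y by apply: gk; exists t.
have ae : \val a < \val e.
  apply/(co s t a e); rewrite ?gs ?gt ?ka ?ke//.
  have /andP[_ st'] := st s; rewrite lt_neqAle st' andbT.
  apply/eqP => /val_inj {}st'; apply: xy.
  by rewrite -gs -gt st'.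
have kE u v : mdist (k u) (k v) = `|\val u - \val v|.
  exact: kk.2.
exists (fun u => k (Rpoint (\val a + u))); split.
- by move=> u v _ _; rewrite kE/=; congr `|_|; lra.
- by rewrite addr0 RpointK.
- rewrite -{1}ka -{1}ke kE distrC ger0_norm ?subr_ge0 ?ltW//.
  by rewrite subrKC RpointK.
Qed.

(** The concatenation of the segment [c] from [x] to [y] with a segment from [y] to
[p] is a geodesic, by the case of equality in the triangle inequality; the line
that straightness attaches to it contains [c] and passes through [p]. *)
Lemma line_beyond x y p (c : R -> X) : x <> y ->
  isometric_on (arc (mdist x y)) c -> c 0 = x -> c (mdist x y) = y ->
  mdist x p = mdist x y + mdist y p ->
  exists k : [set: R] -> X,
    [/\ geodesic k, contained_in (fun u : arc (mdist x y) => c (\val u)) k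
      & range k p].
Proof.
move=> xy cI c0 cy xyp; set L := mdist x y in cI cy xyp *.
have L0 : 0 < L by rewrite mdist_gt0; apply/eqP.
have [f [f0 fp fI]] : exists f : R -> X, [/\ f 0 = y, f (mdist y p) = p &
    isometric_on (arc (mdist y p)) f].
  have [<-|/eqP yp] := eqVneq y p.
    exists (fun=> y); split=> // s t; rewrite /arc/= !(@mdistxx R X) => s0 t0.
    by rewrite (_ : s - t = 0) ?normr0//; lra.
  have [f [fI f0 fp]] := line_through yp; exists f; split=> // s t _ _.
  exact: fI.
set M := mdist y p in xyp fp fI.
have M0 : 0 <= M by exact: mdist_ge0.
pose h u := if u <= L then c u else f (u - L).
(* Only the case s <= L < t is not immediate: the lower bound on the distance
   follows from d(x, p) = L + M. *)
have hI : isometric_on (arc (L + M)) h.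
  apply: isometric_on_le => s t; rewrite /arc/= => sA tA st; rewrite /h.
  have [sL|Ls] := leP s L; have [tL|Lt] := leP t L; last 2 first.
  - by lra.
  - rewrite fI/arc/=; [|by lra..].
    by rewrite distrC ger0_norm; lra.
  - rewrite cI/arc/=; [|by lra..].
    by rewrite distrC ger0_norm; lra.
  have d1 : mdist x (c s) = s.
    by rewrite -c0 cI/arc/=; [rewrite sub0r normrN ger0_norm; lra|by lra..].
  have d2 : mdist (c s) y = L - s.
    rewrite -{1}cy cI/arc/=; [|by lra..].
    by rewrite distrC ger0_norm; lra.
  have d3 : mdist y (f (t - L)) = t - L.
    by rewrite -f0 fI/arc/=; [rewrite sub0r normrN ger0_norm; lra|by lra..].
  have d4 : mdist (f (t - L)) p = L + M - t.
    rewrite -{1}fp fI/arc/=; [|by lra..].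
    by rewrite distrC ger0_norm; lra.
  have t1 := metric_triangle (c s) y (f (t - L)).
  have t2 := metric_triangle x (c s) p.
  have t3 := metric_triangle (c s) (f (t - L)) p.
  by lra.
have h0 : h 0 = x by rewrite /h ltW.
have hp : h (L + M) = p.
  rewrite /h; case: ifPn => [LM|_]; last by rewrite (addrC L) addrK.
  have /mdist_positivity yp : M = 0 by lra.
  by rewrite -yp/= -cy; congr c; lra.
have xp : x <> p.
  by move=> xp; move: xyp; rewrite -xp mdistxx; lra.
have hgeo := geodesic_restrict (@arc_interval _) hI.
have hj : joins (fun u : arc (L + M) => h (\val u)) x p.
  by rewrite -h0 -hp; apply: joins_arc; lra.
have [[k [kk [hk co]]] _] := X_straight xp hgeo hj.
have aP (u : arc L) : \val u \in arc (L + M).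
  by have := set_valP u; rewrite inE /arc/=; lra.
pose inc (u : arc L) : arc (L + M) := exist _ (\val u) (aP u).
have hc (u : arc L) : h (\val (inc u)) = c (\val u).
  by rewrite /h /=; have := set_valP u; rewrite /arc/= => /andP[_ ->].
exists k; split=> //.
- split.
    by move=> _ [u _ <-]; rewrite -hc; apply: hk; exists (inc u).
  move=> s t s' t' gs gt.
  by rewrite -(co (inc s) (inc t)) ?hc.
- by apply: hk; have [_ [t [_ <- _]]] := hj; exists t.
Qed.

(** Geodesics do not branch: the line carrying the segment from [x] to [y] is
unique, so it passes through both [p] and [q], and a point of a line is
determined by its distances to two points of that line. *)
Lemma nonbranching x y p q : x <> y -> mdist y p = mdist y q ->
  mdist x p = mdist x y + mdist y p -> mdist x q = mdist x y + mdist y q ->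
  p = q.
Proof.
move=> xy ypq xyp xyq.
have [c [cI c0 cy]] := line_through xy.
have cA : isometric_on (arc (mdist x y)) c by move=> s t _ _; exact: cI.
have [k [kk ck kp]] := line_beyond xy cA c0 cy xyp.
have [l [ll cl lq]] := line_beyond xy cA c0 cy xyq.
have cgeo := geodesic_restrict (@arc_interval _) cA.
have cj : joins (fun u : arc (mdist x y) => c (\val u)) x y.
  by have := joins_arc c (mdist_ge0 x y); rewrite c0 cy.
have [_ /(_ k l kk ck ll cl)[kl _]] := X_straight xy cgeo cj.
rewrite -kl in lq.
have [s [t [cs ct _]]] := cj.
have [a _ ka] : range k x by apply: ck.1; exists s.
have [e _ ke] : range k y by apply: ck.1; exists t.
have [i _ ki] := kp; have [j _ kj] := lq.
have kE u v : mdist (k u) (k v) = `|\val u - \val v|.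
  exact: kk.2.
rewrite -ki -kj; congr k; apply: val_inj.
have ae : \val a <> \val e by move=> /val_inj ae; apply: xy; rewrite -ka -ke ae.
have : `|\val a - \val i| = `|\val a - \val j|.
  by rewrite -!kE ka ki kj; lra.
have : `|\val e - \val i| = `|\val e - \val j|.
  by rewrite -!kE ke ki kj; lra.
move: ae; move: (\val a) (\val e) (\val i) (\val j) => A E I J AE.
by move=> /eqP; rewrite eqr_norm2 => /orP[] /eqP H1 /eqP;
  rewrite eqr_norm2 => /orP[] /eqP H2 /=; lra.
Qed.

(** From time 1 on the ray follows the line through [b] and [g 1], by
[nonbranching]; [y] is the point of that line at time -1. Before time 1 the
triangle inequality through [g 1] suffices. *)
Lemma ray_backward b (g : half_line R -> X) :
  geodesic g -> g (half_line0 R) = b ->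
  exists2 y, mdist y b = 1 & forall u, mdist y (g u) = 1 + \val u.
Proof.
move=> [_ gg] gb.
have gE s t : mdist (g s) (g t) = `|\val s - \val t|.
  exact: gg.
have bE u : mdist b (g u) = \val u.
  by rewrite -gb gE/= sub0r normrN ger0_norm//; exact: (set_valP u).
have h1 : 1 \in half_line R by rewrite inE /half_line/= ler01.
pose o1 : half_line R := exist _ 1 h1.
have v1 : \val o1 = 1 by [].
have b1 : mdist b (g o1) = 1 by rewrite -gb gE/= sub0r normrN1.
have bg1 : b <> g o1 by move=> E; move: b1; rewrite -E mdistxx; lra.
have [c [cI c0]] := line_through bg1; rewrite b1 => c1.
have cE u v : mdist (c u) (c v) = `|u - v| by exact: cI.
exists (c (-1)); first by rewrite -c0 cE subr0 normrN1.
have far u : 1 <= \val u -> g u = c (\val u).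
  move=> u1; apply: (nonbranching bg1).
  - by rewrite gE -c1 cE.
  - by rewrite !bE gE v1 distrC ger0_norm; lra.
  - rewrite b1 -{1}c0 -c1 !cE sub0r normrN [in RHS]distrC.
    by rewrite !ger0_norm; lra.
move=> u; have [u1|u1] := leP 1 (\val u).
  by rewrite far// cE distrC ger0_norm; lra.
have := metric_triangle (c (-1)) (g u) (g o1).
rewrite -{1}c1 cE gE v1 ler0_norm; last by lra.
rewrite distrC ger0_norm; last by lra.
have := metric_triangle (c (-1)) b (g u).
rewrite -{1}c0 cE bE subr0 normrN1.
by lra.
Qed.

End straight_geometry.

(** * Spaces of nonexpansive functions and compactness *)

Lemma family_cvg_eval {U : topologicalType} {V : uniformType} {T : Type}
    (F : set_system T) (i : T -> {family compact, U -> V})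
    (f : {family compact, U -> V}) (x : U) :
  Filter F -> i @ F --> f -> (fun t => i t x) @ F --> f x.
Proof.
move=> FF /fam_cvgP/(_ _ (@compact_set1 _ x)).
by rewrite uniform_set1.
Qed.

Section nonexpansive.
Context {R : realType} {U V : pseudoMetricType R}.

Definition nonexpansive (f : U -> V) :=
  forall e x y, ball x e y -> ball (f x) e (f y).

Lemma nonexpansive_continuous (f : U -> V) : nonexpansive f -> continuous f.
Proof.
move=> fne x; apply/cvg_ballP => e e0.
by near=> y; apply: fne; near: y; exact: nbhsx_ballx e0.
Unshelve. all: by end_near. Qed.

(** On nonexpansive functions the pointwise topology is that of uniform
convergence on compact sets: finitely many small balls control a compact set. *)
Lemma nonexpansive_cvg_family (F : set_system (U -> V)) (f : U -> V) :
  Filter F -> (\forall g \near F, nonexpansive g) -> nonexpansive f ->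
  (forall x, (fun g => g x) @ F --> f x) -> {family compact, F --> f}.
Proof.
move=> FF Fne fne Fp; apply/fam_cvgP => K cK P /=.
rewrite uniform_nbhs => -[E [entE EP]]; apply: filterS EP _.
move: entE; rewrite -entourage_ballE => -[e /= e0 eE].
have e3 : 0 < e / 3 by rewrite divr_gt0.
suff : \forall g \near F, K `<=` (fun y => ball (f y) e (g y)).
  by apply: filterS => g gK y Ky; apply: eE => /=; exact: gK.
move/compact_near_coveringP: cK; apply=> x Kx; near=> y g.
have xy : ball x (e / 3) y by near: y; exact: nbhsx_ballx e3.
have gne : nonexpansive g by near: g.
have gx : ball (f x) (e / 3) (g x).
  by near: g; move/cvg_ballP : (Fp x); exact.
have -> : e = e / 3 + e / 3 + e / 3 by field.
apply: ball_triangle (gne _ _ _ xy).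
by apply: ball_triangle gx; apply: ball_sym; exact: fne.
Unshelve. all: by end_near. Qed.

(** Joint continuity of the evaluation without local compactness of [U]: the
functions being nonexpansive, [i t' x'] is compared with [i t x] through
[i t' x]. *)
Lemma nonexpansive_eval_continuous {T : topologicalType}
    (i : T -> {family compact, U -> V}) :
  continuous i -> (forall t, nonexpansive (i t)) ->
  continuous (fun w : T * U => i w.1 w.2).
Proof.
move=> ci ine [t x]; apply/cvg_ballP => e e0.
have e2 : 0 < e / 2 by rewrite divr_gt0.
have it : \forall t' \near t, ball (i t x) (e / 2) (i t' x).
  have : i t' x @[t' --> t] --> i t x by exact: family_cvg_eval (ci t).
  by move/cvg_ballP; apply.
near=> w; apply: (@ball_split _ _ (i w.1 x)).
  by near: w; exact: (cvg_fst it).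
apply: ine; near: w; apply: (@cvg_snd _ _ (nbhs t) (nbhs x)).
exact: nbhsx_ballx e2.
Unshelve. all: by end_near. Qed.

End nonexpansive.

Lemma cvg_set_type {T : topologicalType} (A : set T) (F : set_system A) (x : A) :
  Filter F -> val @ F --> val x -> F --> x.
Proof.
move=> FF Fx P [_ [[B oB <-] Bx] BP]; apply: filterS BP _.
by apply: Fx; exact: open_nbhs_nbhs.
Qed.

Lemma set_val_continuous {T : topologicalType} (A : set T) :
  continuous (val : A -> T).
Proof. exact: initial_continuous. Qed.

(** The form in which compactness is used on function spaces: an ultrafilter of
functions with values in compact sets has a pointwise limit. *)
Lemma ultra_fmap_cvg {T : Type} {V : topologicalType} (F : set_system T)
    (f : T -> V) (C : set V) :
  UltraFilter F -> compact C -> (forall t, C (f t)) ->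
  exists2 l, C l & f @ F --> l.
Proof.
move=> UF cC fC; have [l [Cl Fl]] := cC (f @ F) _ (filterE _ fC).
exists l => //= P Pl; have [//|FP] := in_ultra_setVsetC (f @^-1` P) UF.
by have [y [nPy Py]] := Fl (~` P) P FP Pl.
Qed.

(** The tube lemma, read on complements. *)
Lemma closed_projection {S T : topologicalType} (K : set T) (A : set (S * T)) :
  compact K -> closed A -> closed [set x | exists2 y, K y & A (x, y)].
Proof.
move=> cK cA; rewrite -openC openE => x /= nx.
rewrite /interior.
suff : \forall x' \near x, K `<=` (fun y => ~ A (x', y)).
  by apply: filterS => x' x'K [y Ky]; exact: x'K.
move/compact_near_coveringP: cK; apply=> y Ky.
have : nbhs (x, y) (~` A).
  apply: open_nbhs_nbhs; split; first exact: closed_openC.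
  by move=> Axy; apply: nx; exists y.
case=> -[P Q] /= [Px Qy] PQ; exists (Q, P) => // -[y' x'] /= [Qy' Px'].
exact: PQ.
Qed.

Lemma mdist_continuous {R : realType} {X : metricType R} :
  continuous (fun w : X * X => mdist w.1 w.2).
Proof.
move=> [x y]; apply/cvgrPdist_lt => e e0.
have e2 : 0 < e / 2 by rewrite divr_gt0.
have nearp (p : X) : \forall z \near p, mdist p z < e / 2.
  by have := nbhsx_ballx p _ e2; rewrite ballEmdist.
near=> w.
have xw : mdist x w.1 < e / 2 by near: w; exact: cvg_fst (nearp x).
have yw : mdist y w.2 < e / 2 by near: w; exact: (cvg_snd (nearp y)).
rewrite /=; have := metric_triangle x w.1 y; have := metric_triangle w.1 w.2 y.
have := metric_triangle w.1 x w.2; have := metric_triangle x y w.2.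
rewrite (metric_sym w.2 y) (metric_sym w.1 x) ltr_norml.
by lra.
Unshelve. all: by end_near. Qed.

(** [contract] identifies the extended half-line with [[0, 1]], and its metric is
the one pulled back by [contract]. *)
Lemma compact_half_line_bar {R : realType} : compact [set: half_line_bar R].
Proof.
rewrite compact_ultra => F UF _.
have c01 (r : half_line_bar R) : `[0, 1]%classic (contract (\val r)).
  rewrite /= in_itv/=; have := contract_le1 (\val r); rewrite ler_norml.
  case/andP=> _ ->; rewrite andbT -(contract0 R) le_contract.
  exact: (set_valP r).
have [l /=] := ultra_fmap_cvg UF (@segment_compact R 0 1) c01.
rewrite in_itv/= => /andP[l0 l1] Fl.
have lE : contract (expand l) = l.
  by rewrite expandK// inE ger0_norm.
have lP : expand l \in half_line_bar R.
  by rewrite inE /half_line_bar/= -le_contract lE contract0.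
pose lb : half_line_bar R := exist _ (expand l) lP.
exists lb; split=> //; apply: cvg_set_type.
apply/cvg_ballP => e e0; have := Fl; move/cvg_ballP => /(_ _ e0).
by apply: filterS => r; rewrite /ball/= /ereal_ball lE.
Qed.

(** * Rays and horofunctions *)

Lemma cvg_mdist {R : realType} {X : metricType R} {T : Type}
    {F : set_system T} {FF : Filter F} (u v : T -> X) (x y : X) :
  u @ F --> x -> v @ F --> y -> mdist (u t) (v t) @[t --> F] --> mdist x y.
Proof.
move=> ux vy; have := @mdist_continuous R X (x, y).
apply: (@cvg_comp _ _ _ (fun t => (u t, v t)) (fun w => mdist w.1 w.2) F
  (nbhs (x, y)) (nbhs (mdist x y))).
  exact: cvg_pair ux vy.
Qed.

Lemma cvg_near_cstE {R : realType} {T : Type} {F : set_system T}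
    {FF : ProperFilter F} (u : T -> R) (c l : R) :
  (\forall t \near F, u t = c) -> u @ F --> l -> l = c.
Proof.
move=> uc ul; apply: (cvg_unique (@Rhausdorff R) ul).
by apply: cvg_near_cst.
Qed.

Section ray_space.
Context {R : realType} {X : metricType R} (b : X).
Implicit Types (g : rays b) (s t : half_line R).

Lemma ray_mdist g s t : mdist (\val g s) (\val g t) = `|\val s - \val t|.
Proof. by have [[_ ->] _] := set_valP g. Qed.

Lemma ray_origin g : \val g (half_line0 R) = b.
Proof. by have [_ ->] := set_valP g. Qed.

Lemma ray_radius g t : mdist b (\val g t) = \val t.
Proof.
have := ray_mdist g (half_line0 R) t; rewrite ray_origin => ->.
by rewrite sub0r normrN ger0_norm//; exact: (set_valP t).
Qed.

Lemma isometric_nonexpansive (f : half_line R -> X) :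
  (forall s t, mdist (f s) (f t) = `|\val s - \val t|) -> nonexpansive f.
Proof. by move=> fI e s t; rewrite ballEmdist /= fI. Qed.

Lemma ray_eval_continuous :
  continuous (fun w : rays b * half_line R => \val w.1 w.2).
Proof.
apply: (@nonexpansive_eval_continuous _ _ _ _ (fun g : rays b => \val g)).
  exact: set_val_continuous.
move=> g; apply: isometric_nonexpansive; exact: ray_mdist.
Qed.

Hypothesis X_proper : proper_space X.

(** Properness bounds the values at each time in a compact ball, and being an
isometry from [b] is a pointwise closed condition. *)
Lemma compact_rays : compact [set: rays b].
Proof.
rewrite compact_ultra => F UF _.
have pw : forall t : half_line R, exists x : X,
    (fun g : rays b => \val g t) @ F --> x.
  move=> t; have gB g : [set x | mdist b x <= \val t] (\val g t).
    by rewrite /= ray_radius.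
  by have [x _ Fx] := ultra_fmap_cvg UF (@X_proper b (\val t)) gB; exists x.
have [f Ff] := choice pw.
have fI s t : mdist (f s) (f t) = `|\val s - \val t|.
  apply: (cvg_near_cstE (u := fun g => mdist (\val g s) (\val g t)) (F := F)).
    by apply: filterE => g; exact: ray_mdist.
  by apply: cvg_mdist; exact: Ff.
have fb : f (half_line0 R) = b.
  apply: (cvg_unique (@metric_hausdorff _ X) (Ff _)).
  rewrite (_ : (fun g => _) = cst b); first exact: cvg_cst.
  by apply/funext => g; exact: ray_origin.
have fR : rays b (f : {family compact, half_line R -> X}).
  split; last exact: fb.
  split; last by move=> s t; exact: fI.
  move=> s t; rewrite /half_line/= => s0 t0 r /andP[sr _]; exact: le_trans sr.
pose fr : rays b := exist _ (f : {family compact, half_line R -> X}) (mem_set fR).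
exists fr; split=> //; apply: cvg_set_type.
apply: nonexpansive_cvg_family => //.
- apply: (@filterE _ F) => g; apply: isometric_nonexpansive; exact: ray_mdist.
- exact: isometric_nonexpansive.
Qed.

End ray_space.

Section horo_space.
Context {R : realType} {X : metricType R} (o : X).
Implicit Types (x y p q : X) (xi : horo o).

Definition hval xi : {family compact, X -> R} := \val (\val xi).

Lemma hval_emb p x : hval (horo_emb o p) x = mdist p x - mdist p o.
Proof. by []. Qed.

Lemma hval_inj xi xi' : (forall x, hval xi x = hval xi' x) -> xi = xi'.
Proof. by move=> E; do 2 apply: val_inj; exact/funext. Qed.

Lemma hval_continuous : continuous hval.
Proof.
move=> xi; apply: (@continuous_comp _ _ _ (\val : horo o -> cfun) \val).
  exact: set_val_continuous.
exact: set_val_continuous.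
Qed.

Lemma hval_eval x : continuous (fun xi => hval xi x).
Proof.
move=> xi; apply: (@family_cvg_eval _ _ _ (nbhs xi) hval).
exact: hval_continuous.
Qed.

(** Induction principle used to extend to horofunctions the closed conditions that
hold for the functions [d(p, .) - d(p, o)]. *)
Lemma horo_closed_ind (P : set (horo o)) :
  closed P -> (forall p, P (horo_emb o p)) -> forall xi, P xi.
Proof.
move=> cP Pe xi; apply: cP => B [_ [[W oW <-] Wxi] WB].
have [_ [[p _ <-] Wp]] := set_valP xi _ (open_nbhs_nbhs (conj oW Wxi)).
by exists (horo_emb o p); split=> //; exact: WB.
Qed.

Lemma hval_base xi : hval xi o = 0.
Proof.
apply: (@horo_closed_ind (fun xi => hval xi o = 0)) => [|p]; last first.
  by rewrite hval_emb subrr.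
apply: (@preimage_closed _ _ (fun xi => hval xi o) [set 0]); last exact: closed_eq.
by move=> ? _; exact: hval_eval.
Qed.

Lemma hval_lip xi x y : hval xi x - hval xi y <= mdist x y.
Proof.
apply: (@horo_closed_ind (fun xi => hval xi x - hval xi y <= mdist x y)) => [|p].
  apply: (@preimage_closed _ _ (fun xi => hval xi x - hval xi y)
    [set r | r <= mdist x y]); last exact: closed_le.
  by move=> z _; exact: cvgB (@hval_eval x z) (@hval_eval y z).
rewrite !hval_emb; have := metric_triangle p y x.
by rewrite (metric_sym y); lra.
Qed.

Lemma hval_nonexpansive xi : nonexpansive (hval xi).
Proof.
move=> e x y; rewrite ballEmdist/= /ball/= => xye.
have := hval_lip xi x y; have := hval_lip xi y x; rewrite (metric_sym y).
by rewrite ltr_norml; lra.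
Qed.

Lemma horo_eval_continuous :
  continuous (fun w : horo o * X => hval w.1 w.2).
Proof.
apply: nonexpansive_eval_continuous; first exact: hval_continuous.
exact: hval_nonexpansive.
Qed.

Lemma horo_cvg (F : set_system (horo o)) xi : Filter F ->
  (forall x, hval xi' x @[xi' --> F] --> hval xi x) -> F --> xi.
Proof.
move=> FF Fp; do 2 apply: cvg_set_type.
apply: nonexpansive_cvg_family => //.
- by apply: (@filterE _ F) => xi'; exact: (@hval_nonexpansive xi').
- exact: (@hval_nonexpansive xi).
Qed.

(** The pointwise limit of an ultrafilter is nonexpansive, hence continuous and a
limit for uniform convergence on compact sets; it stays in the closure. *)
Lemma compact_horo : compact [set: horo o].
Proof.
rewrite compact_ultra => F UF _.
have pw : forall x : X, exists l : R,
    (fun xi => hval xi x) @ F --> l.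
  move=> x; have xB xi : `[- mdist x o, mdist x o]%classic (hval xi x).
    have := hval_lip xi x o; have := hval_lip xi o x; rewrite hval_base.
    by rewrite /= in_itv/= (metric_sym o); lra.
  have [l _ Fl] := ultra_fmap_cvg UF (@segment_compact R _ _) xB.
  by exists l.
have [f Ff] := choice pw.
have fne : nonexpansive f.
  move=> e x y; rewrite ballEmdist/= => xye.
  have lip u v : f u - f v <= mdist u v.
    apply: (@closed_cvg _ _ F _ (fun xi => hval xi u - hval xi v)
      (fun r => r <= mdist u v)).
    - exact: closed_le.
    - by apply: filterE => xi; exact: hval_lip.
    - exact: cvgB (Ff u) (Ff v).
  have := lip x y; have := lip y x; rewrite (metric_sym y) /ball/=.
  by rewrite ltr_norml; lra.
have cf : continuous f by exact: nonexpansive_continuous.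
pose fc : @cfun _ X := exist _ (f : {family compact, X -> R}) (mem_set cf).
have Ffc : \val @ F --> fc.
  apply: cvg_set_type; apply: nonexpansive_cvg_family => //.
  by apply: (@filterE _ F) => xi'; exact: (@hval_nonexpansive xi').
have fcl : horo_closure o fc.
  apply: (@closed_cvg _ _ F _ (fun xi : horo o => \val xi) (horo_closure o)).
  - exact: closed_closure.
  - by apply: filterE => xi; exact: (set_valP xi).
  - exact: Ffc.
pose fh : horo o := exist _ fc (mem_set fcl).
by exists fh; split=> //; exact: cvg_set_type.
Qed.

Lemma horo_emb_continuous : continuous (horo_emb o).
Proof.
move=> p; apply: horo_cvg => x.
by apply: cvgB; apply: cvg_mdist; (exact: cvg_id || exact: cvg_cst).
Qed.

Lemma horo_emb_inj : injective (horo_emb o).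
Proof.
move=> p q pq.
have E x : mdist p x - mdist p o = mdist q x - mdist q o.
  by rewrite -!hval_emb pq.
have := E p; have := E q; rewrite !mdistxx (metric_sym q p) => Eq Ep.
by apply: mdist_positivity; lra.
Qed.

Lemma dense_horo_emb : dense (range (horo_emb o)).
Proof.
move=> O [xi Oxi] oO; apply: contrapT => nO.
have : (~` O) xi; last exact.
apply: horo_closed_ind => [|p Op]; first exact: open_closedC.
by apply: nO; exists (horo_emb o p); split=> //; exists p.
Qed.

End horo_space.

(** * Busemann points and the embedding by distance functions *)

Section half_line_theory.
Variable R : realType.

Lemma clamp_subproof (r : R) : Num.max 0 r \in half_line R.
Proof. by rewrite inE /half_line/= le_max lexx. Qed.

(** A retraction of the real line onto the half-line, which turns real expressions
into arguments of rays without a proof of nonnegativity. *)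
Definition clamp (r : R) : half_line R := exist _ (Num.max 0 r) (clamp_subproof r).

Lemma clampK (t : half_line R) : clamp (\val t) = t.
Proof. by apply: val_inj => /=; rewrite max_r//; exact: (set_valP t). Qed.

Lemma val_clamp r : 0 <= r -> \val (clamp r) = r.
Proof. by move=> r0; rewrite /= max_r. Qed.

Lemma clamp_continuous : continuous clamp.
Proof.
move=> r; apply: cvg_set_type; apply/cvgrPdist_lt => e e0.
suff : \forall s \near r, `|Num.max 0 r - Num.max 0 s| < e by [].
apply: filterS (@nbhsx_ballx _ _ r e e0) => s.
by rewrite /ball/= !ltr_norml; case: (ltP 0 r); case: (ltP 0 s); lra.
Qed.

#[global] Instance half_line_infty_proper : ProperFilter (half_line_infty R).
Proof.
apply: filter_from_proper => [|M _].
  apply: filter_from_filter; first by exists 0.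
  move=> M N _ _; exists (Num.max M N) => // t /=.
  by rewrite gt_max => /andP[].
by exists (clamp (M + 1)); rewrite /= lt_max ltrDl ltr01 orbT.
Qed.

Lemma half_line_infty_gt (M : R) : \forall t \near half_line_infty R, M < \val t.
Proof. by exists M. Qed.

Lemma nonincreasing_half_line_cvg (u : half_line R -> R) (m : R) :
  (forall s t, \val s <= \val t -> u t <= u s) -> (forall t, m <= u t) ->
  exists l : R, u @ half_line_infty R --> l.
Proof.
move=> ni um; have lb : has_lbound (range u) by exists m => _ [t _ <-].
have hi : has_inf (range u) by split=> //; exists (u (clamp 0)), (clamp 0).
exists (inf (range u)); apply/cvgrPdist_lt => e e0.
have [_ [t0 _ <-] ut0] := inf_adherent e0 hi.
have := half_line_infty_gt (\val t0); apply: filterS => t t0t.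
have := ni _ _ (ltW t0t).
have : inf (range u) <= u t by apply: ge_inf => //; exists t.
by rewrite ltr_norml; lra.
Qed.

End half_line_theory.

Lemma embeddingP {X Y : topologicalType} (f : X -> Y) :
  injective f -> continuous f ->
  (forall x U, nbhs x U -> exists2 V, nbhs (f x) V & f @^-1` V `<=` U) ->
  embedding f.
Proof.
move=> fi fc fU; split=> // U; split=> [oU|[V oV <-]]; last first.
  by move/continuousP: fc; exact.
exists (\bigcup_(V in [set V | open V /\ f @^-1` V `<=` U]) V).
  by apply: bigcup_open => V [].
apply/seteqP; split=> x /=; first by move=> [V [_ VU] Vx]; exact: VU.
move=> Ux; have [V Vx VU] := fU x U (open_nbhs_nbhs (conj oU Ux)).
exists (interior V); last exact: Vx.
split; first exact: open_interior.
by move=> y /interior_subset; exact: VU.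
Qed.

Section busemann_convergence.
Context {R : realType} {X : metricType R} (o b : X).
Hypothesis X_proper : proper_space X.
Implicit Types (g : rays b).

(** By the triangle inequality [d(g t, x) - t] is nonincreasing in [t] and bounded
below by [- d(b, x)], so the values converge at each point; by compactness there
is a cluster point, whose values must be these limits. *)
Lemma busemann_cvg g :
  horo_emb o (\val g t) @[t --> half_line_infty R] --> busemann o (\val g).
Proof.
pose F := horo_emb o (\val g t) @[t --> half_line_infty R].
have mono x : exists l : R, mdist (\val g t) x - \val t @[t --> half_line_infty R] --> l.
  apply: (nonincreasing_half_line_cvg (m := - mdist b x)) => [s t st|t].
    have := metric_triangle (\val g t) (\val g s) x.
    by rewrite ray_mdist ger0_norm ?subr_ge0//; lra.
  have := metric_triangle b x (\val g t).
  by rewrite ray_radius (metric_sym x); lra.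
have [L FL] : exists L : X -> R, forall x, hval xi x @[xi --> F] --> L x.
  have [l lP] := choice mono; exists (fun x => l x - l o) => x.
  have E : (fun t => hval (horo_emb o (\val g t)) x) =
      (fun t => mdist (\val g t) x - \val t) \- (fun t => mdist (\val g t) o - \val t).
    by apply/funext => t; rewrite hval_emb /=; lra.
  have := cvgB (lP x) (lP o); rewrite -[X in X @ _]E.
  exact.
have [xi [_ Fxi]] := @compact_horo R X o F _ filterT.
have : cluster F xi by [].
rewrite cluster_cvgE => -[G PG [Gxi FG]].
have xiL x : hval xi x = L x.
  apply: (@cvg_unique _ (@Rhausdorff R) (hval xi x @[xi --> G])).
    exact: (cvg_comp _ _ Gxi (@hval_eval _ _ o x xi)).
  by apply: cvg_trans (FL x) => A; exact: FG.
apply/cvg_ex; exists xi; apply: horo_cvg => x.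
by rewrite xiL; exact: FL.
Qed.

Lemma busemann_diff g x y (c : R) :
  (\forall t \near half_line_infty R,
    mdist (\val g t) x - mdist (\val g t) y = c) ->
  hval (busemann o (\val g)) x - hval (busemann o (\val g)) y = c.
Proof.
move=> gc; pose B := busemann o (\val g).
have lim z : hval (horo_emb o (\val g t)) z @[t --> half_line_infty R]
    --> hval B z.
  exact: (cvg_comp _ _ (@busemann_cvg g) (@hval_eval _ _ o z B)).
apply: cvg_near_cstE (cvgB (lim x) (lim y)).
by apply: filterS gc => t <-; rewrite /= !fctE !hval_emb; lra.
Qed.

End busemann_convergence.

Section horo_embedding.
Context {R : realType} {X : metricType R} (o : X).
Hypothesis X_proper : proper_space X.
Hypothesis X_uniq : uniquely_geodesic X.
Hypothesis X_straight : straight X.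

(** If [d(x, z) >= e], the point [w] at distance [e] from [x] on a segment from [x]
to [z] satisfies [h x w - h x x = e] and [h z w - h z x = - e], where [h] stands for
[horo_emb o], so [h x] and [h z] are at least [e] apart at [x] or at [w]: a
neighbourhood of [h x] for uniform convergence on the closed ball of radius [e]
around [x] excludes [h z]. *)
Lemma horo_emb_embedding : embedding (horo_emb o).
Proof.
apply: embeddingP; [exact: horo_emb_inj|exact: horo_emb_continuous|].
move=> x U /nbhs_ballP[e /= e0 eU].
pose K := [set w | mdist x w <= e].
pose V : set (horo o) :=
  [set xi | forall w, K w -> ball (hval (horo_emb o x) w) e (hval xi w)].
exists V.
  have entE : entourage [set rs : R * R | ball rs.1 e rs.2].
    by rewrite -entourage_ballE; exists e.
  have := fam_nbhs (hval (horo_emb o x)) entE (@X_proper x e).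
  exact: hval_continuous.
move=> z Vz; apply: eU; rewrite ballEmdist/= ltNge; apply/negP => exz.
have xz : x <> z.
  by move=> xz; move: exz; rewrite xz mdistxx; lra.
have [c [cI c0 cz]] := line_through X_uniq X_straight xz.
have cE s t : mdist (c s) (c t) = `|s - t| by exact: cI.
have dxc : mdist x (c e) = e by rewrite -c0 cE sub0r normrN gtr0_norm.
have dzc : mdist z (c e) = mdist x z - e.
  by rewrite -{1}cz cE ger0_norm ?subr_ge0.
have := Vz (c e); have := Vz x; rewrite /K/= mdistxx dxc => /(_ (ltW e0)) + /(_ (lexx _)).
rewrite /ball/= !hval_emb mdistxx dxc dzc (metric_sym z x) !ltr_norml.
by lra.
Qed.

End horo_embedding.

(** * Polar coordinates on the visual compactification *)

Section polar_coordinates.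
Context {R : realType} {X : metricType R} (b : X).
Implicit Types (g : rays b) (r : half_line_bar R) (z : rays b * half_line_bar R).

(** The point of [X] with polar coordinates [z], meaningful for a finite radius; at
an infinite radius [fine] returns 0 and the value is [b]. *)
Definition polar_point z : X := \val z.1 (clamp (fine (\val z.2))).

Lemma polar_fin z : (\val z.2 < +oo)%E -> polar z = visual_emb b (polar_point z).
Proof.
case: z => g [[s| |] hs] //= _; last by case: (half_line_ninfty hs).
rewrite /polar /polar_point /=; congr (visual_emb _ (\val g _)).
have s0 : s \in half_line R := half_line_EFin hs.
rewrite -[LHS]clampK; congr clamp.
Qed.

Lemma polar_infty g r : \val r = +oo%E -> polar (g, r) = visual_end g.
Proof. by case: r => -[s| |] hs. Qed.

Lemma polar_continuous : continuous (@polar _ _ b).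
Proof. by apply/continuousP => A. Qed.

Lemma near_finite z : (\val z.2 < +oo)%E ->
  \forall z' \near z, (\val z'.2 < +oo :> \bar R)%E.
Proof.
move=> zoo.
have cv : continuous (fun z' : rays b * half_line_bar R => \val z'.2).
  move=> z'; apply: (@cvg_comp _ _ _ snd _ _ (nbhs z'.2)); first exact: cvg_snd.
  exact: set_val_continuous.
apply: (cv z [set r | (r < +oo)%E]); apply: open_nbhs_nbhs; split=> //.
exact: open_ereal_lt_ereal.
Qed.

Lemma polar_point_continuous z : (\val z.2 < +oo)%E ->
  {for z, continuous polar_point}.
Proof.
move=> zoo.
have fz : \val z.2 \is a fin_num.
  by rewrite ge0_fin_numE//; exact: (set_valP z.2).
apply: (@cvg_comp _ _ _
  (fun z' : rays b * half_line_bar R => (z'.1, clamp (fine (\val z'.2))))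
  (fun w : rays b * half_line R => \val w.1 w.2) _
  (nbhs (z.1, clamp (fine (\val z.2))))); last first.
  exact: (@ray_eval_continuous _ _ b (z.1, clamp (fine (\val z.2)))).
have c1 : z'.1 @[z' --> z] --> z.1 by exact: cvg_fst.
have c2 : clamp (fine (\val z'.2)) @[z' --> z] --> clamp (fine (\val z.2)).
  apply: (@cvg_comp _ _ _ (fun z' => fine (\val z'.2)) (@clamp R) _
    (nbhs (fine (\val z.2)))); last exact: clamp_continuous.
  apply: fine_cvg; rewrite fineK//.
  apply: (@cvg_comp _ _ _ snd _ _ (nbhs z.2)); first exact: cvg_snd.
  exact: set_val_continuous.
exact: cvg_pair c1 c2.
Qed.

Lemma visual_emb_inj : injective (visual_emb b).
Proof. by move=> p q []. Qed.

Lemma visual_emb_open (U : set X) : open U -> open (visual_emb b @` U).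
Proof.
move=> oU; rewrite /open/= /visual_open openE => z [p Up zp].
have zoo : (\val z.2 < +oo)%E.
  rewrite ltey; apply/eqP => zoo; case: z zp zoo => g r /= zp zoo.
  by rewrite polar_infty in zp.
have Uz : U (polar_point z).
  by move: zp; rewrite polar_fin// => /visual_emb_inj <-.
have := polar_point_continuous zoo (open_nbhs_nbhs (conj oU Uz)).
rewrite /interior/=; apply: filterS2 (near_finite zoo) => z' z'oo Uz'.
by exists (polar_point z') => //; rewrite polar_fin.
Qed.

End polar_coordinates.

(** * The direction of a horofunction *)

Section direction_of_horofunctions.
Context {R : realType} {X : metricType R} (o b : X).
Implicit Types (g : rays b) (r : half_line_bar R) (xi : horo o) (x y p : X).

Let W := (horo o * ((rays b * half_line_bar R) * X))%type.
Implicit Types w : W.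

(** In [w = (xi, ((g, r), y))], the conditions say that [y] is one unit behind [b]
on a line that continues [g], that [xi] decreases at unit speed along this line
from [y] to the point of radius [r], and that [xi] comes from that point if [r]
is finite. Asking the third condition only for [u < r], a strict inequality,
makes it closed: it reads [r <= u] or an equation. *)
Definition points_to : set W := [set w |
  [/\ forall u : half_line R, mdist w.2.2 (\val w.2.1.1 u) = 1 + \val u,
      hval w.1 w.2.2 - hval w.1 b = 1,
      forall u : half_line R, ((\val u)%:E < \val w.2.1.2)%E ->
        hval w.1 b - hval w.1 (\val w.2.1.1 u) = \val u &
      forall x, \val w.2.1.2 = +oo%E \/
        hval w.1 x = mdist (polar_point w.2.1) x - mdist (polar_point w.2.1) o]].

Let cvg_horo w : w'.1 @[w' --> w] --> w.1. Proof. exact: cvg_fst. Qed.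
Let cvg_polar w : w'.2.1 @[w' --> w] --> w.2.1.
Proof.
by apply: (@cvg_comp _ _ _ snd fst _ (nbhs w.2)); [exact: cvg_snd|exact: cvg_fst].
Qed.
Let cvg_back w : w'.2.2 @[w' --> w] --> w.2.2.
Proof.
by apply: (@cvg_comp _ _ _ snd snd _ (nbhs w.2)); [exact: cvg_snd|exact: cvg_snd].
Qed.
Let cvg_ray w u : \val w'.2.1.1 u @[w' --> w] --> \val w.2.1.1 u.
Proof.
apply: (@cvg_comp _ _ _ (fun w' : W => (w'.2.1.1, u))
  (fun v : rays b * half_line R => \val v.1 v.2) _ (nbhs (w.2.1.1, u)));
  last exact: (@ray_eval_continuous _ _ b (w.2.1.1, u)).
have c1 : w'.2.1.1 @[w' --> w] --> w.2.1.1.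
  by apply: (@cvg_comp _ _ _ _ fst _ (nbhs w.2.1) _ (@cvg_polar w)); exact: cvg_fst.
exact: cvg_pair c1 (cvg_cst u).
Qed.
Let cvg_radius w : \val w'.2.1.2 @[w' --> w] --> \val w.2.1.2.
Proof.
have c1 : w'.2.1.2 @[w' --> w] --> w.2.1.2.
  by apply: (@cvg_comp _ _ _ _ snd _ (nbhs w.2.1) _ (@cvg_polar w)); exact: cvg_snd.
apply: (@cvg_comp _ _ _ _ _ _ (nbhs w.2.1.2) _ c1).
exact: set_val_continuous.
Qed.
Let cvg_hval w (f : W -> X) (x : X) : f @ w --> x ->
  hval w'.1 (f w') @[w' --> w] --> hval w.1 x.
Proof.
move=> fx; apply: (@cvg_comp _ _ _ (fun w' => (w'.1, f w'))
  (fun v => hval v.1 v.2) _ (nbhs (w.1, x)));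
  last exact: (@horo_eval_continuous _ _ o (w.1, x)).
exact: cvg_pair (@cvg_horo w) fx.
Qed.

Let closed_eq_const (f : W -> R) (c : R) :
  continuous f -> closed [set w | f w = c].
Proof.
move=> cf; apply: (@preimage_closed _ _ f [set c]); last exact: closed_eq.
by move=> w _; exact: cf.
Qed.

(** The last condition is closed although [polar_point] is discontinuous at infinite
radius, because it is void there: near a point where it fails, the radius stays
finite and [polar_point] is continuous. *)
Lemma closed_points_to : closed points_to.
Proof.
have -> : points_to =
  \bigcap_(u in [set: half_line R])
    [set w : W | mdist w.2.2 (\val w.2.1.1 u) = 1 + \val u] `&`
  [set w : W | hval w.1 w.2.2 - hval w.1 b = 1] `&`
  \bigcap_(u in [set: half_line R])
    ([set w : W | (\val w.2.1.2 <= (\val u)%:E)%E] `|`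
     [set w : W | hval w.1 b - hval w.1 (\val w.2.1.1 u) = \val u]) `&`
  \bigcap_(x in [set: X]) [set w : W | \val w.2.1.2 = +oo%E \/
    hval w.1 x = mdist (polar_point w.2.1) x - mdist (polar_point w.2.1) o].
  apply/seteqP; split=> w.
    move=> [h1 h2 h3 h4]; split; last by move=> x _; exact: h4.
    split; last first.
      move=> u _ /=; have [ru|ur] := leP (\val w.2.1.2) (\val u)%:E; first by left.
      by right; exact: h3.
    by split=> // u _; exact: h1.
  move=> [[[h1 h2] h3] h4]; split=> //.
  - by move=> u; exact: h1.
  - by move=> u ur; have [/=|//] := h3 u I; rewrite leNgt ur.
  - by move=> x; exact: h4.
apply: closedI; [apply: closedI; [apply: closedI|]|].
- apply: closed_bigI => u _; apply: closed_eq_const => w.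
  exact: cvg_mdist (@cvg_back w) (@cvg_ray w u).
- apply: closed_eq_const => w.
  exact: cvgB (cvg_hval (@cvg_back w)) (cvg_hval (cvg_cst b)).
- apply: closed_bigI => u _; apply: closedU.
    apply: (@preimage_closed _ _ (fun w : W => \val w.2.1.2)
      [set e : \bar R | (e <= (\val u)%:E)%E]).
      by move=> w _; exact: cvg_radius.
    exact: closed_ereal_ge_ereal.
  apply: closed_eq_const => w.
  exact: cvgB (cvg_hval (cvg_cst b)) (cvg_hval (@cvg_ray w u)).
- apply: closed_bigI => x _; rewrite -openC openE => w /= /not_orP[woo /eqP wx].
  have rfin : (\val w.2.1.2 < +oo)%E by rewrite ltey; apply/eqP.
  have nfin : \forall w' \near w, (\val w'.2.1.2 < +oo :> \bar R)%E.
    exact: (@cvg_polar w _ (near_finite rfin)).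
  have cp : polar_point w'.2.1 @[w' --> w] --> polar_point w.2.1.
    exact: (@cvg_comp _ _ _ _ _ _ (nbhs w.2.1) _ (@cvg_polar w)
      (polar_point_continuous rfin)).
  have cd : hval w'.1 x - (mdist (polar_point w'.2.1) x -
      mdist (polar_point w'.2.1) o) @[w' --> w] --> hval w.1 x -
      (mdist (polar_point w.2.1) x - mdist (polar_point w.2.1) o).
    apply: cvgB (cvg_hval (cvg_cst x)) _.
    exact: cvgB (cvg_mdist cp (cvg_cst x)) (cvg_mdist cp (cvg_cst o)).
  move/cvgr_neq0: cd; rewrite subr_eq0 => /(_ wx); rewrite /interior /=.
  apply: filterS2 nfin => w' w'oo; rewrite subr_eq0 => w'x [].
    by move=> E; move: w'oo; rewrite /= E ltxx.
  by move=> E; move: w'x; rewrite E eqxx.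
Qed.

Lemma points_to_finite xi g r y : points_to (xi, ((g, r), y)) ->
  (\val r < +oo)%E -> xi = horo_emb o (polar_point (g, r)).
Proof.
move=> [_ _ _ /= h] roo; apply: hval_inj => x; have [E|//] := h x.
by rewrite E ltxx in roo.
Qed.

Lemma points_to_infinite xi g r y (u : half_line R) :
  points_to (xi, ((g, r), y)) -> \val r = +oo%E ->
  hval xi b - hval xi (\val g u) = \val u.
Proof. by move=> [_ _ /= h _] roo; apply: h; rewrite roo ltry. Qed.

(** The function [d(p, .)] is bounded below, so it cannot decrease at unit speed
along a whole ray. *)
Lemma horo_emb_not_infinite p g r y :
  points_to (horo_emb o p, ((g, r), y)) -> \val r <> +oo%E.
Proof.
move=> pt roo; have M0 : 0 <= mdist p b + 1 by rewrite addr_ge0 ?mdist_ge0.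
have := points_to_infinite (clamp (mdist p b + 1)) pt roo.
rewrite val_clamp// !hval_emb.
by have := mdist_ge0 p (\val g (clamp (mdist p b + 1))); lra.
Qed.

Hypothesis X_uniq : uniquely_geodesic X.
Hypothesis X_straight : straight X.

(** The point [y] behind [b] forces [d(y, g' u) = 1 + u = d(y, g u)], and geodesics
do not branch at [b]. *)
Lemma direction_unique xi g r y g' r' y' :
  points_to (xi, ((g, r), y)) -> points_to (xi, ((g', r'), y')) ->
  \val r = +oo%E -> \val r' = +oo%E -> g = g'.
Proof.
move=> pt pt' roo roo'; have [/= yg xy _ _] := pt.
have yb : mdist y b = 1.
  by rewrite -(ray_origin g) yg addr0.
apply: val_inj; apply/funext => u /=.
have yg' : mdist y (\val g' u) = 1 + \val u.
  have := points_to_infinite u pt' roo'.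
  have := hval_lip xi y (\val g' u).
  by have := metric_triangle y b (\val g' u); rewrite yb ray_radius; lra.
apply: (nonbranching X_uniq X_straight (x := y) (y := b)).
- by move=> E; move: yb; rewrite E mdistxx; lra.
- by rewrite !ray_radius.
- by rewrite yb ray_radius yg.
- by rewrite yb ray_radius yg'.
Qed.

Lemma points_to_functional xi g r y g' r' y' :
  points_to (xi, ((g, r), y)) -> points_to (xi, ((g', r'), y')) ->
  polar (g, r) = polar (g', r').
Proof.
have [roo|roo] := eqVneq (\val r) +oo%E; have [roo'|roo'] := eqVneq (\val r') +oo%E.
- move=> pt pt'; rewrite !polar_infty//.
  by rewrite (direction_unique pt pt' roo roo').
- move=> pt pt'; rewrite (points_to_finite pt') ?ltey// in pt.
  by have := horo_emb_not_infinite pt.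
- move=> pt pt'; rewrite (points_to_finite pt) ?ltey// in pt'.
  by have := horo_emb_not_infinite pt'.
- move=> pt pt'; rewrite !polar_fin ?ltey//; congr visual_emb.
  by apply: (@horo_emb_inj _ _ o); rewrite -(points_to_finite pt) ?ltey//
    (points_to_finite pt') ?ltey.
Qed.

(** Coordinates are read off the line from [b] through [p], whose point at time -1
is behind [b]; for [p = b] any line through [b] does, whence the point [q]. *)
Lemma horo_emb_points_to p q : q <> b ->
  exists g r y, [/\ mdist b y <= 1, points_to (horo_emb o p, ((g, r), y)) &
    polar (g, r) = visual_emb b p].
Proof.
move=> qb; have [c [cI c0 cp]] : exists c : R -> X,
    [/\ isometric_on setT c, c 0 = b & c (mdist b p) = p].
  have [<-|/eqP bp] := eqVneq b p; last exact: line_through.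
  have [c [cI c0 _]] := line_through X_uniq X_straight (nesym qb).
  by exists c; rewrite mdistxx.
have cE s t : mdist (c s) (c t) = `|s - t| by exact: cI.
pose f : {family compact, half_line R -> X} := fun u => c (\val u).
have gP : rays b f.
  split; last exact: c0.
  apply: geodesic_restrict; last by move=> s t _ _; exact: cE.
  by move=> s t; rewrite /half_line/= => s0 t0 u /andP[su _]; exact: le_trans su.
pose g : rays b := exist _ f (mem_set gP).
have rP : (mdist b p)%:E \in half_line_bar R.
  by rewrite inE /half_line_bar/= lee_fin mdist_ge0.
pose r : half_line_bar R := exist _ (mdist b p)%:E rP.
have gE u : \val g u = c (\val u) by [].
have pE s : mdist p (c s) = `|mdist b p - s| by rewrite -{1}cp cE.
have gr : polar_point (g, r) = p.
  by rewrite /polar_point gE val_clamp ?mdist_ge0.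
exists g, r, (c (-1)); split.
- by rewrite -c0 cE sub0r opprK normr1.
- have u0 (u : half_line R) : 0 <= \val u by exact: (set_valP u).
  split.
  + move=> u; rewrite -[LHS]/(mdist (c (-1)) (c (\val u))) cE.
    by have ? := u0 u; rewrite ler0_norm; lra.
  + rewrite !hval_emb pE (metric_sym p b).
    by have L0 := mdist_ge0 b p; rewrite ger0_norm; lra.
  + move=> u; rewrite -[X in (_ < X)%E]/(mdist b p)%:E lte_fin => ur.
    rewrite -[X in _ - hval _ X]/(c (\val u)) !hval_emb.
    by rewrite pE (metric_sym p b) ger0_norm; lra.
  + by move=> x; right; rewrite gr hval_emb.
- by rewrite polar_fin ?ltry// gr.
Qed.

Hypothesis X_proper : proper_space X.

Lemma pinfty_half_line_bar : +oo%E \in half_line_bar R.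
Proof. by rewrite inE /half_line_bar/= leey. Qed.

Lemma busemann_points_to g : exists r y,
  [/\ mdist b y <= 1, points_to (busemann o (\val g), ((g, r), y)) &
    polar (g, r) = visual_end g].
Proof.
pose r : half_line_bar R := exist _ +oo%E pinfty_half_line_bar.
have [gg g0] := set_valP g.
have [y yb yg] := ray_backward X_uniq X_straight gg g0.
exists r, y; split; last exact: polar_infty.
  by rewrite metric_sym yb.
split=> //=; last by left.
  apply: busemann_diff => //; apply: filterE => t.
  by rewrite !(metric_sym (\val g t)) yg ray_radius; lra.
move=> u _; apply: busemann_diff => //.
apply: filterS (half_line_infty_gt (\val u)) => t ut.
rewrite metric_sym ray_radius ray_mdist ger0_norm ?subr_ge0 ?ltW//; exact: subKr.
Qed.

Definition polar_box : set ((rays b * half_line_bar R) * X) :=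
  ([set: rays b] `*` [set: half_line_bar R]) `*` [set y | mdist b y <= 1].

Lemma compact_polar_box : compact polar_box.
Proof.
apply: compact_setX; last exact: X_proper.
by apply: compact_setX; [exact: compact_rays|exact: compact_half_line_bar].
Qed.

(** The horofunctions that have coordinates form a closed set, as a projection along
a compact set, and this set contains the image of [X]. *)
Lemma horo_points_to q : q <> b ->
  forall xi, exists2 z, polar_box z & points_to (xi, z).
Proof.
move=> qb.
apply: (horo_closed_ind (closed_projection compact_polar_box closed_points_to)) => p.
have [g [r [y [yb pt _]]]] := horo_emb_points_to p qb.
by exists ((g, r), y).
Qed.

(** [Pi xi] is the point with any coordinates to which [xi] is related. Then the
preimage of a closed set [C] is the projection of the part of [points_to] whose
coordinates lie in the closed set [polar^-1(C)]. *)
Lemma horo_to_visual q : q <> b -> exists Pi : horo o -> visual b,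
  [/\ continuous Pi,
      forall g, Pi (busemann o (\val g)) = visual_end g &
      forall p, Pi (horo_emb o p) = visual_emb b p].
Proof.
move=> qb; have ex xi : exists z, polar_box z /\ points_to (xi, z).
  by have [z] := horo_points_to qb xi; exists z.
have [f fP] := choice ex; pose Pi xi := polar (f xi).1.
have PiE xi g r y : points_to (xi, ((g, r), y)) -> Pi xi = polar (g, r).
  move=> pt; have [_] := fP xi; rewrite /Pi; case: (f xi) => -[g' r'] y' /= pt'.
  exact: points_to_functional pt' pt.
exists Pi; split=> [|g|p].
- apply/continuous_closedP => C cC.
  have -> : Pi @^-1` C = [set xi | exists2 z, polar_box z &
      (points_to `&` (fun w => w.2.1) @^-1` (@polar _ _ b @^-1` C)) (xi, z)].
    apply/seteqP; split=> xi /=.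
      by move=> Cxi; have [Kf ptf] := fP xi; exists (f xi).
    by move=> [[[g r] y] _ [pt /= Cz]]; rewrite (PiE _ _ _ _ pt).
  apply: closed_projection; first exact: compact_polar_box.
  apply: closedI; first exact: closed_points_to.
  have/continuous_closedP := @polar_continuous _ _ b => /(_ _ cC) cpC.
  apply: preimage_closed cpC => w _; exact: cvg_polar.
- have [r [y [_ pt <-]]] := busemann_points_to g; exact: PiE pt.
- have [g [r [y [_ pt <-]]]] := horo_emb_points_to p qb; exact: PiE pt.
Qed.

End direction_of_horofunctions.

(** * The horofunction compactification is finer than the visual one *)

Theorem theorem1p1 (R : realType) (X : metricType R)
    (X_proper : proper_space X) (X_uniq : uniquely_geodesic X)
    (X_straight : straight X) (o b : X) :
  (exists Pi : horo o -> visual b,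
    [/\ continuous Pi,
        range Pi = [set: visual b],
        forall g : rays b,
          horo_emb o (\val g t) @[t --> half_line_infty R]
            --> busemann o (\val g) /\
          Pi (busemann o (\val g)) = visual_end g &
        forall p : X, Pi (horo_emb o p) = visual_emb b p]) /\
  finer (horo_emb o) (visual_emb b).
Proof.
have [Pi [cPi Pi_end Pi_emb]] : exists Pi : horo o -> visual b,
    [/\ continuous Pi,
        forall g, Pi (busemann o (\val g)) = visual_end g &
        forall p, Pi (horo_emb o p) = visual_emb b p].
  have [[q qb]|X1] := pselect (exists q, q <> b).
    exact: (horo_to_visual o X_uniq X_straight X_proper qb).
  (* A one-point space carries no ray, and [polar] is then not surjective. *)
  have Xb p : p = b by apply: contrapT => pb; apply: X1; exists p.
  exists (fun=> visual_emb b b); split=> [|g|p]; first exact: cst_continuous.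
    have := ray_radius g (clamp 1).
    by rewrite (Xb (\val g _)) mdistxx val_clamp// => /esym/eqP; rewrite oner_eq0.
  by rewrite (Xb p).
have Pi_surj : range Pi = [set: visual b].
  apply/seteqP; split=> // -[p|g] _; first by exists (horo_emb o p).
  by exists (busemann o (\val g)).
split.
  by exists Pi; split=> // g; split=> //; exact: busemann_cvg.
have PiE : Pi \o horo_emb o = visual_emb b by apply/funext => p; exact: Pi_emb.
split; last by exists Pi.
  split; [exact: compact_horo|exact: horo_emb_embedding|exact: dense_horo_emb].
split.
- rewrite -Pi_surj; apply: continuous_compact; last exact: compact_horo.
  exact: continuous_subspaceT.
- apply: embeddingP; first exact: visual_emb_inj.
    rewrite -PiE => p; apply: continuous_comp; last exact: cPi.
    exact: horo_emb_continuous.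
  move=> p U; rewrite nbhsE => -[U' [oU' U'p] U'U].
  exists (visual_emb b @` U').
    apply: open_nbhs_nbhs; split; first exact: visual_emb_open.
    by exists p.
  by move=> q [q' U'q' /visual_emb_inj <-]; exact: U'U.
- move=> U [v Uv] oU.
  have [xi _ xiv] : range Pi v by rewrite Pi_surj.
  have [xi' [Up [p _ pE]]] : Pi @^-1` U `&` range (horo_emb o) !=set0.
    apply: dense_horo_emb; first by exists xi; rewrite /= xiv.
    by move/continuousP: cPi; exact.
  by exists (visual_emb b p); split; [rewrite -Pi_emb pE|exists p].
Qed.
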